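(* Let $s\in\mathbb{R}$. There exist infinitely many functions $V\in C^\infty(\mathbb{R}^2\setminus O,\mathbb{R})$ such that the system with Hamiltonian $$H=\frac{|p|^2}{2}-\frac{s}{|q|}-V(q_1,q_2)$$ allows any focused parabola with the $q_1$-axis as the main axis as an integrable reflection wall.
   Context: $q=(q_1,q_2)\in\mathbb{R}^2\setminus O$, with $O$ the origin, and $p=(p_1,p_2)$ is the conjugate momentum. A parabola is focused when its focus is the origin $O$. A curve $\mathcal{B}$ is an integrable reflection wall for the system $H$ if the mechanical billiard, in which the particle moves according to $H$ and is reflected elastically at $\mathcal{B}$ (tangential component of the momentum kept, normal component reversed), possesses on each energy hypersurface of $H$ an additional non-trivial first integral, independent of $H$, preserved by the motion and by the reflections. It is not required that the billiard mapping be always well-defined. *)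

(* Defs.v *)
From HB Require Import structures.
From mathcomp Require Import all_boot all_order all_algebra.
From mathcomp Require Import all_classical all_reals all_analysis.

Set Implicit Arguments.
Unset Strict Implicit.
Unset Printing Implicit Defensive.

Import Order.TTheory GRing.Theory Num.Theory.
Import numFieldNormedType.Exports.

Local Open Scope classical_set_scope.
Local Open Scope ring_scope.

(* [f] is of class C^n on the open set [D]; only the values of [f] on [D]
   matter. *)
Fixpoint class_C (R : realType) (U : normedModType R) (D : set U) (n : nat)
    (f : U -> R) : Prop :=
  match n with
  | 0 => forall x, D x -> {for x, continuous f}
  | m.+1 => (forall x, D x -> differentiable f x) /\
            (forall v, class_C D m (fun x => 'D_v f x))
  end.

Definition smooth_on (R : realType) (U : normedModType R) (D : set U)
    (f : U -> R) : Prop := forall n, class_C D n f.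

Notation plane R := (R * R)%type.

Section Plane.
Variable R : realType.
Implicit Types (F q n p v : plane R) (A B : set (plane R)).

Definition dot p q : R := p.1 * q.1 + p.2 * q.2.

(* The canonical norm [`|q|] on a product is the sup norm, so the Euclidean
   norm has to be named separately. *)
Definition enorm q : R := Num.sqrt (dot q q).

Definition punctured_plane : set (plane R) := [set q | q <> 0].

Definition q1_axis : set (plane R) := [set q | q.2 = 0].

(* Focus-directrix definition; the directrix is the line [dot n q = c]. *)
Definition is_parabola B F A : Prop :=
  exists n (c : R), [/\ n <> 0, dot n F <> c,
    B = [set q | enorm (q - F) = `|dot n q - c| / enorm n] &
    A = [set q | exists t : R, q = F + t *: n] ].

Definition focused_parabola B A : Prop := is_parabola B 0 A.

Definition tangent_to B q v : Prop :=
  exists gamma : R -> plane R,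
    [/\ gamma 0 = q, \forall t \near (0 : R), B (gamma t) &
        is_derive (0 : R) (1 : R) gamma v].

Definition normal_to B q n : Prop := forall v, tangent_to B q v -> dot n v = 0.

Definition elastic_reflection B q p p' : Prop :=
  (forall v, tangent_to B q v -> dot p' v = dot p v) /\
  (forall n, normal_to B q n -> dot p' n = - dot p n).

End Plane.

Arguments punctured_plane : clear implicits.
Arguments q1_axis : clear implicits.

(* Points [(q, p)] of the cotangent bundle. *)
Notation phase R := (plane R * plane R)%type.

Section Mechanics.
Variable R : realType.
Implicit Types (H G : phase R -> R) (E : R) (B : set (plane R)).

Definition phase_space : set (phase R) := [set x | punctured_plane R x.1].

(* (dH/dp1, dH/dp2, - dH/dq1, - dH/dq2) *)
Definition hamiltonian_field H (x : phase R) : phase R :=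
  (('D_((0, 0), (1, 0)) H x, 'D_((0, 0), (0, 1)) H x),
   (- 'D_((1, 0), (0, 0)) H x, - 'D_((0, 1), (0, 0)) H x)).

Definition motion H (a b : R) (x : R -> phase R) : Prop :=
  forall t, a < t < b ->
    phase_space (x t) /\ is_derive t (1 : R) x (hamiltonian_field H (x t)).

Definition energy_level H E : set (phase R) :=
  [set x | phase_space x /\ H x = E].

(* The part of the level set on which it is a hypersurface. *)
Definition regular_energy_level H E : set (phase R) :=
  [set x | energy_level H E x /\ exists v, 'D_v H x <> 0].

Definition preserved_by_motion H E G : Prop :=
  forall (a b : R) (x : R -> phase R), motion H a b x ->
    (forall t, a < t < b -> energy_level H E (x t)) ->
    forall t u, a < t < b -> a < u < b -> G (x t) = G (x u).

Definition preserved_by_reflections H E B G : Prop :=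
  forall q p p' : plane R, B q -> energy_level H E (q, p) ->
    elastic_reflection B q p p' -> G (q, p') = G (q, p).

Definition differentials_free H G (x : phase R) : Prop :=
  forall a b : R, (forall v, a * 'D_v H x + b * 'D_v G x = 0) ->
    a = 0 /\ b = 0.

(* Functional independence in the usual sense: the differentials are linearly
   independent on a dense (automatically open) part of the hypersurface. *)
Definition independent_on_level H E G : Prop :=
  regular_energy_level H E `<=`
    closure [set x | energy_level H E x /\ differentials_free H G x].

(* [G] may depend on the energy [E]. *)
Definition integrable_reflection_wall H B : Prop :=
  forall E, exists G, [/\ smooth_on phase_space G,
    preserved_by_motion H E G,
    preserved_by_reflections H E B G &
    independent_on_level H E G].

Definition hamiltonian (s : R) (V : plane R -> R) (x : phase R) : R :=
  enorm x.2 ^+ 2 / 2 - s / enorm x.1 - V x.1.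

End Mechanics.

(* Main.v *)
(** The potentials are V = c q1, i.e. the Kepler problem with force center O in
    a uniform field along the axis.  It separates in parabolic coordinates, and
      G = p2 (q1 p2 - q2 p1) - s q1 / |q| + (c / 2) q2 ^ 2
    is a first integral.  Its part quadratic in p has no cross term between the
    tangent and the normal of a focused parabola with axis the q1-axis, so G is
    invariant under elastic reflection.  Where p <> 0, rotating p slightly
    keeps the energy and makes the p-derivatives of H and G independent; where
    p = 0 and the force does not vanish, moving q along the force frees some
    kinetic energy, which reduces to the previous case. *)
Require Import Defs.
From mathcomp Require Import all_boot all_order all_algebra.
From mathcomp Require Import all_classical all_reals all_analysis.
From mathcomp Require Import ring lra.
Import numFieldNormedType.Exports.
Import Order.TTheory GRing.Theory Num.Theory.
Local Open Scope classical_set_scope.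
Local Open Scope ring_scope.

Set Implicit Arguments.
Unset Strict Implicit.
Unset Printing Implicit Defensive.

(** * Chain rules and rules for directional derivatives *)

Section Calculus.
Context {R : realType}.

Section Chain.
Context {U W : normedModType R}.

Lemma is_derive_curve (f : U -> W) (g : R -> U) (t : R) (v : U) :
  differentiable f (g t) -> is_derive t (1 : R) g v ->
  is_derive t (1 : R) (fun u => f (g u)) ('D_v f (g t)).
Proof.
move=> df dg; have dgt : differentiable g t by apply/derivable1_diffP; case: dg.
have dfg : differentiable (f \o g) t by exact: differentiable_comp.
apply: DeriveDef; first exact: diff_derivable.
by rewrite deriveE// diff_comp//= -(deriveE (1 : R) dgt) derive_val deriveE.
Qed.

End Chain.

Section Coordinates.
Context {U W1 W2 : normedModType R}.

Lemma continuous_fst : continuous (fst : W1 * W2 -> W1).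
Proof. by move=> x; exact: cvg_fst. Qed.

Lemma continuous_snd : continuous (snd : W1 * W2 -> W2).
Proof. by move=> x; exact: cvg_snd. Qed.

Lemma differentiable_fst (x : W1 * W2) : differentiable fst x.
Proof. by apply: linear_differentiable; exact: continuous_fst. Qed.

Lemma differentiable_snd (x : W1 * W2) : differentiable snd x.
Proof. by apply: linear_differentiable; exact: continuous_snd. Qed.

Lemma is_derive_linear (f : {linear U -> W1}) (x v : U) :
  continuous f -> is_derive x v f (f v).
Proof.
move=> cf; have df : differentiable f x by exact: linear_differentiable.
by apply: DeriveDef; [exact: diff_derivable|rewrite deriveE// diff_lin].
Qed.

End Coordinates.

Lemma is_derive_comp_real {U : normedModType R} (phi : R -> R) (f : U -> R)
    (x v : U) (a df : R) :
  is_derive (f x) (1 : R) phi a -> differentiable f x -> is_derive x v f df ->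
  is_derive x v (fun y => phi (f y)) (a * df).
Proof.
move=> dphi dfx dfv.
have dphix : differentiable phi (f x) by apply/derivable1_diffP; case: dphi.
have dc : differentiable (phi \o f) x by exact: differentiable_comp.
apply: DeriveDef; first exact: diff_derivable.
rewrite deriveE// diff_comp//= -(deriveE v dfx) derive_val.
by rewrite -[df in LHS]mulr1 linearZ /= -(deriveE (1 : R) dphix) derive_val mulrC.
Qed.

(** The derivative is written as a polynomial in the function itself, which lets the induction on
    the order in [class_C_rsqrt] close up. *)
Lemma is_derive_rsqrt (r : R) : 0 < r ->
  is_derive r (1 : R) (fun u => (Num.sqrt u)^-1) (- (Num.sqrt r)^-1 ^+ 3 / 2).
Proof.
move=> r0; have s0 : Num.sqrt r != 0 by rewrite gt_eqF ?sqrtr_gt0.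
have := is_derive1_sqrt r0 => dsqrt.
apply: (is_derive_eq (@is_deriveV _ Num.sqrt r _ 1 s0 dsqrt)).
by rewrite /GRing.scale /=; field.
Qed.

Section Rules.
Context {U : normedModType R}.
Implicit Types (f g : U -> R) (x v : U).

Lemma is_derive_add f g x v df dg : is_derive x v f df -> is_derive x v g dg ->
  is_derive x v (fun y => f y + g y) (df + dg).
Proof. exact: is_deriveD. Qed.

Lemma is_derive_sub f g x v df dg : is_derive x v f df -> is_derive x v g dg ->
  is_derive x v (fun y => f y - g y) (df - dg).
Proof. exact: is_deriveB. Qed.

Lemma is_derive_mul f g x v df dg : is_derive x v f df -> is_derive x v g dg ->
  is_derive x v (fun y => f y * g y) (f x * dg + g x * df).
Proof. exact: is_deriveM. Qed.

Lemma is_derive_const (k : R) x v : is_derive x v (fun=> k) 0.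
Proof. exact: is_derive_cst. Qed.

(** The first-order expansion of [f] at [x] is also one of [g], with the same linear part;
    uniqueness of the differential then identifies that part with the differential of [g]. *)
Lemma near_eq_differentiable f g x : (\near x, f x = g x) ->
  differentiable f x -> differentiable g x.
Proof.
move=> fg df; have [cd fE] := (diff_locallyP x f).1 df.
have gE : g \o shift x = cst (g x) + 'd f x +o_ (0 : U) id.
  apply/eqaddoP => e e0.
  have /eqaddoP/(_ e e0) := fE.
  have : \forall h \near (0 : U), f (h + x) = g (h + x).
    have := near_shift (0 : U) x (fun y => f y = g y); rewrite propeqE => -[+ _].
    by move/(_ fg); apply: filterS => h /=; rewrite subr0.
  apply: filterS2 => h /= fgh; rewrite !fctE /= fgh.
  by rewrite (nbhs_singleton fg).
have dE := diff_unique cd gE.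
apply/diff_locallyP; by rewrite dE.
Qed.

End Rules.

(** * Closure properties of the class C^n on an open set *)

Section Smooth.
Context {U : normedModType R} (D : set U).
Hypothesis openD : open D.
Implicit Types f g : U -> R.

(** As [D] is open, equality on [D] is equality near each of its points, so the directional
    derivatives agree on [D] as well and the induction proceeds. *)
Lemma class_C_ext n f g : {in D, f =1 g} -> class_C D n f -> class_C D n g.
Proof.
have near_fg (f' g' : U -> R) x : {in D, f' =1 g'} -> D x ->
    \forall y \near x, f' y = g' y.
  move=> fg Dx; have : \forall y \near x, D y by exact: open_nbhs_nbhs.
  by apply: filterS => y Dy; rewrite fg ?inE.
elim: n f g => [|n IH] f g fg /=.
  move=> cf x Dx; rewrite /prop_for /continuous_at -fg ?inE//.
  apply: cvg_trans (cf x Dx); apply: near_eq_cvg.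
  exact: near_fg.
case=> df Cf; split=> [x Dx|v].
  by apply: near_eq_differentiable (df _ Dx); exact: near_fg.
apply: IH (Cf v) => x; rewrite inE => Dx.
by apply: near_eq_derive; exact: near_fg.
Qed.

(** Lets the derivative be given by a formula valid only on [D], in place of ['D_v f], whose values
    elsewhere are not controlled. *)
Lemma class_CS n f : (forall x, D x -> differentiable f x) ->
  (forall v, exists2 g, class_C D n g & forall x, D x -> is_derive x v f (g x)) ->
  class_C D n.+1 f.
Proof.
move=> df Cf; split=> // v; have [g Cg fg] := Cf v.
apply: class_C_ext Cg => x; rewrite inE => Dx.
by have dfx := fg x Dx; rewrite derive_val.
Qed.

Lemma class_C_le n f : class_C D n.+1 f -> class_C D n f.
Proof.
elim: n f => [f [df _] x Dx|n IH f [df Cf]].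
  exact: differentiable_continuous (df x Dx).
by split=> // v; exact: IH.
Qed.

Lemma class_C_is_derive n f x v : class_C D n.+1 f -> D x ->
  is_derive x v f ('D_v f x).
Proof. by case=> df _ Dx; apply/derivableP/diff_derivable/df. Qed.

Lemma class_C_cst n (k : R) : class_C D n (fun=> k).
Proof.
elim: n k => [k x _|n IH k]; first exact: cst_continuous.
apply: class_CS => [x _|v]; first exact: differentiable_cst.
by exists (fun=> 0) => // x _; exact: is_derive_const.
Qed.

Lemma class_C_linear n (f : {linear U -> R}) : continuous f -> class_C D n f.
Proof.
case: n => [cf x _|n cf]; first exact: cf.
apply: class_CS => [x _|v]; first exact: linear_differentiable.
by exists (fun=> f v) => [|x _]; [exact: class_C_cst|exact: is_derive_linear].
Qed.

Lemma class_C_add n f g : class_C D n f -> class_C D n g ->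
  class_C D n (fun x => f x + g x).
Proof.
elim: n f g => [f g cf cg x Dx|n IH f g Cf Cg].
  by apply: continuousD; [exact: cf|exact: cg].
apply: class_CS => [x Dx|v].
  by apply: differentiableD; [exact: Cf.1|exact: Cg.1].
exists (fun x => 'D_v f x + 'D_v g x) => [|x Dx]; first exact: IH (Cf.2 v) (Cg.2 v).
exact: is_derive_add (class_C_is_derive v Cf Dx) (class_C_is_derive v Cg Dx).
Qed.

Lemma class_C_mul n f g : class_C D n f -> class_C D n g ->
  class_C D n (fun x => f x * g x).
Proof.
elim: n f g => [f g cf cg x Dx|n IH f g Cf Cg].
  by apply: continuousM; [exact: cf|exact: cg].
apply: class_CS => [x Dx|v].
  by apply: differentiableM; [exact: Cf.1|exact: Cg.1].
exists (fun x => f x * 'D_v g x + g x * 'D_v f x) => [|x Dx].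
  by apply: class_C_add; apply: IH;
    [exact: class_C_le|exact: Cg.2|exact: class_C_le|exact: Cf.2].
exact: is_derive_mul (class_C_is_derive v Cf Dx) (class_C_is_derive v Cg Dx).
Qed.

Lemma class_C_rsqrt n f : (forall x, D x -> 0 < f x) -> class_C D n f ->
  class_C D n (fun x => (Num.sqrt (f x))^-1).
Proof.
move=> f0; elim: n => [cf x Dx|n IH Cf].
  apply: (@continuous_comp _ _ _ f (fun u : R => (Num.sqrt u)^-1)).
    exact: cf.
  apply: differentiable_continuous.
  by apply/derivable1_diffP; have [] := is_derive_rsqrt (f0 x Dx).
apply: class_CS => [x Dx|v].
  apply: (@differentiable_comp _ _ _ _ f (fun u : R => (Num.sqrt u)^-1)).
    exact: Cf.1.
  by apply/derivable1_diffP; have [] := is_derive_rsqrt (f0 x Dx).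
exists (fun x => - (Num.sqrt (f x))^-1 ^+ 3 / 2 * 'D_v f x) => [|x Dx].
  have Cr := IH (class_C_le Cf).
  apply: class_C_mul (Cf.2 v).
  apply: class_C_ext (class_C_mul (class_C_cst _ (- 2^-1))
    (class_C_mul Cr (class_C_mul Cr Cr))) => x _ /=.
  by set r := (Num.sqrt _)^-1; field.
exact: (is_derive_comp_real (is_derive_rsqrt (f0 x Dx)) (Cf.1 x Dx)
  (class_C_is_derive v Cf Dx)).
Qed.


End Smooth.
End Calculus.

(** * Limits of curves and closures *)

Lemma cvg_point_pair (S T U : topologicalType) (f : S -> T) (g : S -> U) (y : S) (a : T) (b : U) :
  f t @[t --> y] --> a -> g t @[t --> y] --> b -> (f t, g t) @[t --> y] --> (a, b).
Proof. by move=> fa gb; exact: cvg_pair fa gb. Qed.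

(** One-sided, because the curves used below are only shown to lie in the desired set for small
    positive parameters. *)
Lemma closure_right (R : realType) (T : topologicalType) (A : set T) (gamma : R -> T) (y : T) :
  gamma t @[t --> (0 : R)^'+] --> y -> (\forall t \near (0 : R)^'+, A (gamma t)) ->
  closure A y.
Proof.
move=> gy gA B By; have gB := gy B By.
have FF : ProperFilter (0 : R)^'+ by exact: at_right_proper_filter.
have /filter_ex[t ABt] : \forall t \near (0 : R)^'+, (A `&` B) (gamma t).
  exact: filterI gA gB.
by exists (gamma t).
Qed.

(** * The Euclidean norm and openness of the phase space *)

Section Plane.
Variable R : realType.
Implicit Types q v : R * R.

Lemma dot_gt0 q : (0 < dot q q) = (q != 0).
Proof.
case: q => a b; rewrite /dot /= -!expr2 xpair_eqE negb_and.
rewrite lt_def addr_ge0 ?sqr_ge0// andbT paddr_eq0 ?sqr_ge0// !sqrf_eq0.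
by rewrite negb_and.
Qed.

Lemma enorm_gt0 q : q <> 0 -> 0 < enorm q.
Proof. by move=> /eqP q0; rewrite sqrtr_gt0 dot_gt0. Qed.

Lemma sqr_enorm q : enorm q ^+ 2 = q.1 ^+ 2 + q.2 ^+ 2.
Proof. by rewrite sqr_sqrtr /dot -!expr2 ?addr_ge0 ?sqr_ge0. Qed.

Lemma punctured_planeE : punctured_plane R = [set q | 0 < dot q q].
Proof.
by apply/seteqP; split=> q /=; rewrite /punctured_plane /= dot_gt0; move/eqP.
Qed.

Lemma continuous_dot : continuous (fun q : R * R => dot q q).
Proof.
move=> q; apply: cvgD; apply: cvgM.
- exact: cvg_fst.
- exact: cvg_fst.
- exact: cvg_snd.
- exact: cvg_snd.
Qed.

Lemma open_punctured_plane : open (punctured_plane R).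
Proof.
rewrite punctured_planeE; apply: (@open_comp _ _ (fun q => dot q q) [set r | 0 < r]).
  by move=> q _; exact: continuous_dot.
exact: open_gt.
Qed.

Lemma open_phase_space : open (phase_space (R:=R)).
Proof.
apply: (@open_comp _ _ fst (punctured_plane R)).
  by move=> q _; exact: continuous_fst.
exact: open_punctured_plane.
Qed.

End Plane.

(** * The Kepler problem in a uniform field and its first integral *)

Section Stark.
Variables (R : realType) (s c : R).
Implicit Types (x v : phase R) (n : nat).

Let H : phase R -> R := hamiltonian s (fun q => c * q.1).

(* The component of the Runge-Lenz vector along the axis, corrected for the uniform field. *)
Definition stark_integral (x : phase R) : R :=
  x.2.2 * (x.1.1 * x.2.2 - x.1.2 * x.2.1) - s * (x.1.1 * (enorm x.1)^-1)
  + c / 2 * (x.1.2 * x.1.2).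

Local Notation G := stark_integral.

(** The coordinates as bundled linear maps, so that [class_C_linear] and [is_derive_linear] apply to
    them. *)
Let q1 : {linear phase R -> R} := fst \o fst.
Let q2 : {linear phase R -> R} := snd \o fst.
Let p1 : {linear phase R -> R} := fst \o snd.
Let p2 : {linear phase R -> R} := snd \o snd.

Let continuous_coords :
  [/\ continuous q1, continuous q2, continuous p1 & continuous p2].
Proof.
split=> x; apply: continuous_comp.
- exact: continuous_fst.
- exact: continuous_fst.
- exact: continuous_fst.
- exact: continuous_snd.
- exact: continuous_snd.
- exact: continuous_fst.
- exact: continuous_snd.
- exact: continuous_snd.
Qed.

Let Cq1 (D : set (phase R)) n : open D -> class_C D n q1.
Proof. by move=> oD; apply: class_C_linear oD _ _ _; case: continuous_coords. Qed.
Let Cq2 (D : set (phase R)) n : open D -> class_C D n q2.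
Proof. by move=> oD; apply: class_C_linear oD _ _ _; case: continuous_coords. Qed.
Let Cp1 (D : set (phase R)) n : open D -> class_C D n p1.
Proof. by move=> oD; apply: class_C_linear oD _ _ _; case: continuous_coords. Qed.
Let Cp2 (D : set (phase R)) n : open D -> class_C D n p2.
Proof. by move=> oD; apply: class_C_linear oD _ _ _; case: continuous_coords. Qed.

Let Dq1 x v : is_derive x v (fun y : phase R => y.1.1) v.1.1.
Proof. by apply: (@is_derive_linear _ _ _ q1); case: continuous_coords. Qed.
Let Dq2 x v : is_derive x v (fun y : phase R => y.1.2) v.1.2.
Proof. by apply: (@is_derive_linear _ _ _ q2); case: continuous_coords. Qed.
Let Dp1 x v : is_derive x v (fun y : phase R => y.2.1) v.2.1.
Proof. by apply: (@is_derive_linear _ _ _ p1); case: continuous_coords. Qed.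
Let Dp2 x v : is_derive x v (fun y : phase R => y.2.2) v.2.2.
Proof. by apply: (@is_derive_linear _ _ _ p2); case: continuous_coords. Qed.

Let Cdot (D : set (phase R)) n : open D ->
  class_C D n (fun x => dot x.1 x.1).
Proof.
move=> oD; have C1 := Cq1 n oD; have C2 := Cq2 n oD.
exact: class_C_add oD _ _ _ (class_C_mul oD C1 C1) (class_C_mul oD C2 C2).
Qed.

Lemma smooth_stark_integral : smooth_on (@phase_space R) G.
Proof.
move=> n; have oP := @open_phase_space R.
have C1 := Cq1 n oP; have C2 := Cq2 n oP.
have C3 := Cp1 n oP; have C4 := Cp2 n oP.
have Cr : class_C (@phase_space R) n (fun x => (enorm x.1)^-1).
  apply: class_C_rsqrt (Cdot n oP) => // x xP.
  by rewrite dot_gt0; exact/eqP.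
have Cc k := class_C_cst oP n k.
have CM f g := @class_C_mul _ _ _ oP n f g.
have CD f g := @class_C_add _ _ _ oP n f g.
(* [G] is assembled from sums and products only; differences become products with the constants [-1]
   and [- s]. *)
have := CD _ _ (CD _ _ (CM _ _ C4 (CD _ _ (CM _ _ C1 C4) (CM _ _ (Cc (-1)) (CM _ _ C2 C3))))
  (CM _ _ (Cc (- s)) (CM _ _ C1 Cr))) (CM _ _ (Cc (c / 2)) (CM _ _ C2 C2)).
apply: class_C_ext oP _ _ _ _ => x _.
by rewrite /G /=; ring.
Qed.

Let Dr x v : phase_space x -> is_derive x v (fun y : phase R => (enorm y.1)^-1)
  (- dot x.1 v.1 * (enorm x.1)^-1 ^+ 3).
Proof.
move=> xP; have d0 : 0 < dot x.1 x.1 by rewrite dot_gt0; exact/eqP.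
have dd : differentiable (fun y : phase R => dot y.1 y.1) x.
  by have [+ _] := Cdot 1 (@openT (phase R)); exact.
have dv : is_derive x v (fun y : phase R => dot y.1 y.1) (2 * dot x.1 v.1).
  apply: is_derive_eq; first exact: is_derive_add (is_derive_mul (Dq1 x v) (Dq1 x v))
    (is_derive_mul (Dq2 x v) (Dq2 x v)).
  by rewrite /dot; ring.
apply: (is_derive_eq (@is_derive_comp_real _ _ _ (fun y => dot y.1 y.1) _ _ _ _
  (is_derive_rsqrt d0) dd dv)).
by rewrite -/(enorm _); set r := (enorm _)^-1; field.
Qed.

Lemma is_derive_stark x v : phase_space x ->
  is_derive x v H
    (dot x.2 v.2 + s * dot x.1 v.1 * (enorm x.1)^-1 ^+ 3 - c * v.1.1).
Proof.
move=> xP; have -> : H = fun y : phase R =>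
    (y.2.1 * y.2.1 + y.2.2 * y.2.2) * 2^-1 - s * (enorm y.1)^-1 - c * y.1.1.
  by apply/funext => y; rewrite /H /hamiltonian sqr_enorm !expr2.
have Dc k := is_derive_const k x v.
apply: is_derive_eq.
  apply: is_derive_sub (is_derive_mul (Dc c) (Dq1 x v)).
  apply: is_derive_sub (is_derive_mul (Dc s) (Dr v xP)).
  apply: is_derive_mul (Dc 2^-1).
  exact: is_derive_add (is_derive_mul (Dp1 x v) (Dp1 x v))
    (is_derive_mul (Dp2 x v) (Dp2 x v)).
by rewrite /dot; set r := (enorm _)^-1; field.
Qed.

Lemma is_derive_stark_integral x v : phase_space x ->
  is_derive x v G
    (v.2.2 * (x.1.1 * x.2.2 - x.1.2 * x.2.1)
     + x.2.2 * (v.1.1 * x.2.2 + x.1.1 * v.2.2 - v.1.2 * x.2.1 - x.1.2 * v.2.1)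
     - s * v.1.1 * (enorm x.1)^-1
     + s * x.1.1 * dot x.1 v.1 * (enorm x.1)^-1 ^+ 3 + c * x.1.2 * v.1.2).
Proof.
move=> xP; have Dc k := is_derive_const k x v.
apply: is_derive_eq.
  apply: is_derive_add; last exact:
    is_derive_mul (Dc (c / 2)) (is_derive_mul (Dq2 x v) (Dq2 x v)).
  apply: is_derive_sub; last exact:
    is_derive_mul (Dc s) (is_derive_mul (Dq1 x v) (Dr v xP)).
  apply: is_derive_mul (Dp2 x v) _.
  exact: is_derive_sub (is_derive_mul (Dq1 x v) (Dp2 x v))
    (is_derive_mul (Dq2 x v) (Dp1 x v)).
by rewrite /dot; set r := (enorm _)^-1; field.
Qed.

(** This is the Poisson bracket of [G] and [H]. The terms in [c] cancel identically; those in [s]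
    leave s p1 (|q|^2 / |q|^3 - 1 / |q|) = 0. *)
Lemma derive_stark_integral_along_field x : phase_space x ->
  'D_(hamiltonian_field H x) G x = 0.
Proof.
move=> xP; have DH v := derive_val (is_derive := is_derive_stark v xP).
have dG := is_derive_stark_integral (hamiltonian_field H x) xP.
rewrite derive_val /hamiltonian_field !DH /dot /=.
have r0 : enorm x.1 != 0 by rewrite gt_eqF ?enorm_gt0.
have := sqr_enorm x.1; move: r0; set r := enorm _ => r0 rE.
have rV : r^-1 = r^-1 ^+ 3 * (x.1.1 ^+ 2 + x.1.2 ^+ 2) by rewrite -rE; field.
transitivity (s * x.2.1 * (r^-1 ^+ 3 * (x.1.1 ^+ 2 + x.1.2 ^+ 2) - r^-1)).
  by set w := r^-1; ring.
by rewrite -rV subrr mulr0.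
Qed.

(** By the chain rule [G] has zero derivative along the motion; the mean value theorem on the
    segment from [t] to [u] gives constancy. *)
Lemma stark_integral_preserved_by_motion E : preserved_by_motion H E G.
Proof.
move=> a b x mx _ t u.
have dG w : a < w < b -> is_derive w (1 : R) (fun z => G (x z)) 0.
  move=> wab; have [xP dx] := mx w wab.
  apply: is_derive_eq (derive_stark_integral_along_field xP).
  by apply: is_derive_curve => //; exact: (smooth_stark_integral 1).1.
wlog tu : t u / t <= u => [th tab uab|tab uab].
  by case: (leP t u) => [|/ltW] /th ->.
have sub w : t <= w <= u -> a < w < b.
  by move: tab uab => /andP[? ?] /andP[? ?] /andP[? ?]; apply/andP; split; lra.
have [||w _] := @MVT_segment R (fun z => G (x z)) (fun=> 0) t u tu.
- move=> w; rewrite in_itv /= => /andP[/ltW ? /ltW ?].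
  by apply: dG; apply: sub; apply/andP.
- apply: derivable_within_continuous => w; rewrite in_itv /= => wtu.
  by have [] := dG w (sub w wtu).
by rewrite mul0r => /eqP; rewrite subr_eq0 => /eqP.
Qed.

(* This p-minor of the Jacobian of (H, G) is, up to a positive factor, the product of the
   momenta conjugate to the parabolic coordinates. *)
Definition momentum_minor x : R :=
  2 * x.1.1 * x.2.1 * x.2.2 - x.1.2 * (x.2.1 ^+ 2 - x.2.2 ^+ 2).

(** Testing the relation on the two momentum directions gives a homogeneous 2 by 2 system in [a],
    [b] with determinant [momentum_minor x]; Cramer's rule finishes. *)
Lemma differentials_free_stark x : phase_space x -> momentum_minor x != 0 ->
  differentials_free H G x.
Proof.
move=> xP M0 a b ab.
have DH v := derive_val (is_derive := is_derive_stark v xP).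
have DG v := derive_val (is_derive := is_derive_stark_integral v xP).
have := ab ((0, 0), (1, 0)); have := ab ((0, 0), (0, 1)).
rewrite !DH !DG /dot /= => e2 e1.
have {}e1 : a * x.2.1 - b * (x.1.2 * x.2.2) = 0 by rewrite -[RHS]e1; ring.
have {}e2 : a * x.2.2 + b * (2 * x.1.1 * x.2.2 - x.1.2 * x.2.1) = 0.
  by rewrite -[RHS]e2; ring.
split; apply: (mulIf M0); rewrite mul0r /momentum_minor; last first.
  transitivity ((a * x.2.2 + b * (2 * x.1.1 * x.2.2 - x.1.2 * x.2.1)) * x.2.1
    - (a * x.2.1 - b * (x.1.2 * x.2.2)) * x.2.2); first by ring.
  by rewrite e1 e2 !mul0r subr0.
transitivity ((a * x.2.1 - b * (x.1.2 * x.2.2)) * (2 * x.1.1 * x.2.2 - x.1.2 * x.2.1)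
  + (a * x.2.2 + b * (2 * x.1.1 * x.2.2 - x.1.2 * x.2.1)) * (x.1.2 * x.2.2)).
  by ring.
by rewrite e1 e2 !mul0r addr0.
Qed.

(** * Density of the points of an energy level with independent differentials *)

Let level_free E := [set x | energy_level H E x /\ differentials_free H G x].

(** With q and p read as complex numbers, [momentum_minor] is the imaginary part of conj(q) p^2.
    Rotating p by [t] keeps |p|, hence the energy, and multiplies this number by exp(2it). If it is
    real and nonzero, it leaves the real line for small [t > 0]. *)
Lemma closure_level_free_of_momentum E x : energy_level H E x -> x.2 != 0 ->
  closure (level_free E) x.
Proof.
move=> xE p0; have [xP HE] := xE.
have [M0|M0] := eqVneq (momentum_minor x) 0; last first.
  by apply: subset_closure; split=> //; exact: differentials_free_stark.
pose gamma (t : R) : phase R := (x.1,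
  (cos t * x.2.1 - sin t * x.2.2, sin t * x.2.1 + cos t * x.2.2)).
have g0 : gamma 0 = x.
  rewrite /gamma cos0 sin0 !mul0r !mul1r subr0 add0r.
  by case: (x) => [[? ?] [? ?]].
apply: (@closure_right R _ _ gamma).
  rewrite -g0; apply: cvg_at_right_filter.
  apply: cvg_point_pair; first exact: cvg_cst.
  apply: cvg_point_pair; [apply: cvgB|apply: cvgD]; apply: cvgM;
    by [exact: cvg_cst|exact: continuous_cos|exact: continuous_sin].
near=> t.
have t0 : 0 < t by near: t; exact: nbhs_right_gt.
have tpi : t < pi / 2.
  by near: t; apply: nbhs_right_lt; rewrite divr_gt0 ?pi_gt0.
have ct : 0 < cos t by apply: cos_gt0_pihalf; rewrite tpi andbT; lra.
have st : 0 < sin t by apply: sin_gt0_pi; rewrite t0; lra.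
have cs := cos2Dsin2 t.
have gP : phase_space (gamma t) by [].
split.
  split=> //; rewrite -HE /H /hamiltonian !sqr_enorm /=; congr (_ / 2 - _ - _).
  transitivity ((cos t ^+ 2 + sin t ^+ 2) * (x.2.1 ^+ 2 + x.2.2 ^+ 2)); first by ring.
  by rewrite cs mul1r.
apply: differentials_free_stark => //.
(* [N] is the real part of conj(q) p^2, so [NE] below computes the squared modulus |q|^2 |p|^4. *)
pose N := x.1.1 * (x.2.1 ^+ 2 - x.2.2 ^+ 2) + 2 * x.1.2 * x.2.1 * x.2.2.
have -> : momentum_minor (gamma t) =
    (cos t ^+ 2 - sin t ^+ 2) * momentum_minor x + 2 * cos t * sin t * N.
  by rewrite /momentum_minor /N /=; ring.
rewrite M0 mulr0 add0r !mulf_neq0 ?pnatr_eq0 ?(gt_eqF ct) ?(gt_eqF st)//.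
have NE : momentum_minor x ^+ 2 + N ^+ 2 = dot x.1 x.1 * dot x.2 x.2 ^+ 2.
  by rewrite /momentum_minor /N /dot; ring.
rewrite M0 expr0n add0r in NE; rewrite -sqrf_eq0 NE.
by rewrite gt_eqF// mulr_gt0 ?exprn_gt0 ?dot_gt0//; exact/eqP.
Unshelve. all: by end_near. Qed.

Lemma independent_on_level_stark E : independent_on_level H E G.
Proof.
move=> x [xE [v dv]]; have [x20|] := eqVneq x.2 0; last first.
  exact: closure_level_free_of_momentum.
have [xP HE] := xE.
have DH u := is_derive_stark u xP.
have [p10 p20] : x.2.1 = 0 /\ x.2.2 = 0 by rewrite x20.
(* At p = 0 the differential of [H] sees only the position part of [v]; up to a sign this part is a
   direction in which [H] decreases. *)
have [a a0] : exists a : R * R, 'D_(a, (0, 0)) H x < 0.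
  have Da a : 'D_(a, (0, 0)) H x = s * dot x.1 a * (enorm x.1)^-1 ^+ 3 - c * a.1.
    by rewrite (derive_val (is_derive := DH _)) /dot /=; ring.
  have : 'D_(v.1, (0, 0)) H x != 0.
    rewrite Da; apply/eqP => d0; apply: dv.
    by rewrite (derive_val (is_derive := DH _)) -[RHS]d0 /dot p10 p20; ring.
  rewrite neq_lt => /orP[?|v0]; first by exists v.1.
  exists (- v.1); move: v0; rewrite !Da -oppr_gt0 /dot /=.
  by congr (_ < _); ring.
pose y t : phase R := t *: ((a, (0, 0)) : phase R) + x.
have y0 : y 0 = x by rewrite /y scale0r add0r.
have [dH _] := DH (a, (0, 0)).
have y_cvg : y t @[t --> (0 : R)] --> x.
  rewrite -[X in _ --> X]y0; apply: cvgD; last exact: cvg_cst.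
  by apply: cvgZl; exact: cvg_id.
have Hy_cvg : H (y t) @[t --> (0 : R)] --> E.
  have /derivable1P/derivable1_diffP/differentiable_continuous := dH.
  by rewrite /prop_for /continuous_at /= scale0r add0r HE.
(* The potential energy lost along [y] is returned as kinetic energy, which puts [gamma t] back on
   the level [E] once [H (y t) < E]. *)
pose gamma t : phase R := ((y t).1, (Num.sqrt (2 * (E - H (y t))), 0)).
have Hy2 t : (y t).2 = 0 by rewrite -[LHS]/(t *: (0 : R * R) + x.2) x20 scaler0 addr0.
(* A closure is closed, so approximation by points of the level with nonzero momentum suffices. *)
apply: (@closed_closure _ (level_free E)).
have sub : [set z | energy_level H E z /\ z.2 != 0] `<=` closure (level_free E).
  by move=> z [zE z0]; exact: closure_level_free_of_momentum.
apply: (closure_subset sub); apply: (@closure_right R _ _ gamma).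
  have -> : x = (x.1, (Num.sqrt (2 * (E - E)), 0)).
    by rewrite subrr mulr0 sqrtr0 [LHS]surjective_pairing x20.
  apply: cvg_at_right_filter; apply: cvg_point_pair.
    by apply: cvg_comp y_cvg _; exact: cvg_fst.
  apply: cvg_point_pair; last exact: cvg_cst.
  apply: cvg_comp; last exact: sqrt_continuous.
  by apply: cvgM; [exact: cvg_cst|apply: cvgB => //; exact: cvg_cst].
have Hy_lt : \forall t \near (0 : R)^'+, H (y t) < E.
  have := cvg_dnbhs_at_right dH.
  move=> /(cvgr_lt _)/(_ 0 a0) Hlt.
  near=> t; have t0 : 0 < t by near: t; exact: nbhs_right_gt.
  have : t^-1 * (H (y t) - H x) < 0 by near: t.
  by rewrite pmulr_rlt0 ?invr_gt0// subr_lt0 HE.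
have y_P : \forall t \near (0 : R)^'+, phase_space (y t).
  have y_right : y t @[t --> (0 : R)^'+] --> x.
    by rewrite -[X in _ --> X]y0; apply: cvg_at_right_filter; rewrite y0.
  have Px : nbhs x (@phase_space R).
    by apply: open_nbhs_nbhs; split=> //; exact: open_phase_space.
  exact: (y_right _ Px).
near=> t.
have tE : H (y t) < E by near: t.
have tP : phase_space (y t) by near: t.
split; last first.
  by apply/eqP => -[/eqP]; rewrite gt_eqF// sqrtr_gt0 mulr_gt0 ?subr_gt0.
have HyD m : 0 <= m -> H ((y t).1, (Num.sqrt (2 * m), 0)) = H (y t) + m.
  move=> m0; rewrite /H /hamiltonian !sqr_enorm Hy2 sqr_sqrtr ?mulr_ge0//=.
  by set r := (enorm _)^-1; field.
by split=> //; rewrite /gamma HyD ?subr_ge0 ?(ltW tE)//; ring.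
Unshelve. all: by end_near. Qed.

End Stark.

(** * Focused parabolas and elastic reflection at them *)

Section Parabola.
Variable R : realType.
Implicit Types (q v p : R * R) (d : R) (B : set (R * R)).

(** The squared focus-directrix equation |q|^2 = (q1 - d)^2, with directrix q1 = d. *)
Definition parabola d : set (R * R) := [set q | q.2 ^+ 2 = d ^+ 2 - 2 * d * q.1].

(** The axis forces [n.2 = 0], so the directrix is q1 = c / n1; it misses the focus, whence
    [d != 0]. Both sides of the focus-directrix equation are nonnegative and may be squared. *)
Lemma focused_parabolaE B : focused_parabola B (q1_axis R) ->
  exists2 d, d != 0 & B = parabola d.
Proof.
case=> n [c [n0 c0 -> axis]].
have n2 : n.2 = 0.
  suff : q1_axis R n by [].
  by rewrite axis; exists 1; rewrite scale1r add0r.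
have n1 : n.1 != 0.
  by apply/eqP => n1; apply: n0; rewrite [LHS]surjective_pairing n1 n2.
exists (c / n.1).
  rewrite mulf_neq0 ?invr_eq0//; apply/eqP => c00; apply: c0.
  by rewrite c00 /dot !mulr0 addr0.
have nE : enorm n = `|n.1| by rewrite /enorm /dot n2 mulr0 addr0 -expr2 sqrtr_sqr.
have sqE q : q.2 ^+ 2 = (c / n.1) ^+ 2 - 2 * (c / n.1) * q.1 <->
    enorm q ^+ 2 = (`|dot n q - c| / enorm n) ^+ 2.
  rewrite sqr_enorm nE -normf_div real_normK ?num_real// /dot n2 mul0r addr0.
  have -> : ((n.1 * q.1 - c) / n.1) ^+ 2 =
      q.1 ^+ 2 + ((c / n.1) ^+ 2 - 2 * (c / n.1) * q.1) by field.
  by split=> [->//|/addrI].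
apply/seteqP; split=> q /=; rewrite subr0 => qE; first by apply/sqE; rewrite qE.
apply/eqP; rewrite -(@eqrXn2 _ 2) ?divr_ge0 ?normr_ge0 ?sqrtr_ge0//.
by apply/eqP/sqE.
Qed.

Lemma is_derive_pair (f g : R -> R) (t a b : R) :
  is_derive t (1 : R) f a -> is_derive t (1 : R) g b ->
  is_derive t (1 : R) (fun u => (f u, g u)) (a, b).
Proof.
move=> df dg.
have dft : differentiable f t by apply/derivable1_diffP; case: df.
have dgt : differentiable g t by apply/derivable1_diffP; case: dg.
have dfg := differentiable_pair dft dgt.
apply: DeriveDef; first exact: diff_derivable.
rewrite deriveE// diff_pair//= -(deriveE (1 : R) dft) -(deriveE (1 : R) dgt).
by rewrite !derive_val.
Qed.

Lemma tangent_parabola d q : d != 0 -> parabola d q ->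
  tangent_to (parabola d) q (q.2, - d).
Proof.
move=> d0 qB.
(* The second coordinate is taken affine in [t]; the equation of the parabola then determines the
   first. *)
pose gamma t := (q.1 + q.2 * t - d / 2 * (t * t), q.2 - d * t).
have gB t : parabola d (gamma t).
  rewrite /parabola /=; move: qB; rewrite /parabola /= => qB.
  transitivity (q.2 ^+ 2 - 2 * d * q.2 * t + d ^+ 2 * t ^+ 2); first by ring.
  by rewrite qB; field.
exists gamma; split.
- by rewrite /gamma !mulr0 subr0 addr0 subr0 -surjective_pairing.
- by near=> t.
have Dc k := is_derive_const k (0 : R) (1 : R).
have Did := is_derive_id (0 : R) (1 : R).
apply: is_derive_pair.
  apply: (is_derive_eq (is_derive_sub (is_derive_add (Dc _) (is_derive_mul (Dc _) Did))
    (is_derive_mul (Dc _) (is_derive_mul Did Did)))).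
  by ring.
by apply: (is_derive_eq (is_derive_sub (Dc _) (is_derive_mul (Dc _) Did))); ring.
Unshelve. all: by end_near. Qed.

(** Differentiating q2^2 + 2 d q1 = d^2 along a curve in the parabola gives twice the desired
    relation. *)
Lemma normal_parabola d q : parabola d q -> normal_to (parabola d) q (d, q.2).
Proof.
move=> qB v [gamma [g0 gB dg]].
have D1 : is_derive (0 : R) (1 : R) (fun t => (gamma t).1) v.1.
  apply: is_derive_eq.
    by apply: is_derive_curve dg; exact: differentiable_fst.
  have D := @is_derive_linear _ _ _ fst (gamma 0) v.
  by have {}D := D (@continuous_fst _ _ _); rewrite derive_val.
have D2 : is_derive (0 : R) (1 : R) (fun t => (gamma t).2) v.2.
  apply: is_derive_eq.
    by apply: is_derive_curve dg; exact: differentiable_snd.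
  have D := @is_derive_linear _ _ _ snd (gamma 0) v.
  by have {}D := D (@continuous_snd _ _ _); rewrite derive_val.
have Dc k := is_derive_const k (0 : R) (1 : R).
have D := is_derive_add (is_derive_mul D2 D2) (is_derive_mul (Dc (2 * d)) D1).
have const : \forall t \near (0 : R),
    (gamma t).2 * (gamma t).2 + 2 * d * (gamma t).1 = d ^+ 2.
  by apply: filterS gB => t; rewrite /parabola /= -expr2 => ->; ring.
have D0 := near_eq_is_derive const D.
have := derive_val (is_derive := D0).
rewrite derive_cst g0 => /esym E; apply: (@mulfI _ 2); first by rewrite pnatr_eq0.
by rewrite mulr0 -[RHS]E /dot /=; ring.
Qed.

(* On the parabola the quadratic form [p2 * (q1 * p2 - q2 * p1)] has no cross term between the
   tangent [(q2, - d)] and the normal [(d, q2)]. *)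
Lemma stark_integral_preserved_by_reflections (s c E d : R) (H : phase R -> R) : d != 0 ->
  preserved_by_reflections H E (parabola d) (stark_integral s c).
Proof.
move=> d0 q p p' qB _ [ptan pnorm].
have T := ptan _ (tangent_parabola d0 qB); have N := pnorm _ (normal_parabola qB).
move: T N; rewrite /dot /= => T N.
have n0 : q.2 ^+ 2 + d ^+ 2 != 0.
  by rewrite gt_eqF// ltr_wpDl ?sqr_ge0// exprn_even_gt0.
have q1E : q.1 = (d ^+ 2 - q.2 ^+ 2) / (2 * d).
  by move: qB; rewrite /parabola /= => ->; field.
(* Solving [T] and [N] in the orthogonal basis of tangent and normal gives p' = p - 2 b n / |n|^2,
   with n = (d, q2) and b = p . n. *)
pose b := p.1 * d + p.2 * q.2.
have p1E : p'.1 = p.1 - 2 * b * d / (q.2 ^+ 2 + d ^+ 2).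
  have : (q.2 ^+ 2 + d ^+ 2) * p'.1 =
    q.2 * (p'.1 * q.2 + p'.2 * - d) + d * (p'.1 * d + p'.2 * q.2) by ring.
  rewrite T N => /(canRL (mulKf n0)) ->; rewrite /b; field.
  by [].
have p2E : p'.2 = p.2 - 2 * b * q.2 / (q.2 ^+ 2 + d ^+ 2).
  have : (q.2 ^+ 2 + d ^+ 2) * p'.2 =
    - d * (p'.1 * q.2 + p'.2 * - d) + q.2 * (p'.1 * d + p'.2 * q.2) by ring.
  rewrite T N => /(canRL (mulKf n0)) ->; rewrite /b; field.
  by [].
(* Only the part quadratic in the momentum changes at a reflection. *)
rewrite /stark_integral /=; congr (_ - _ + _).
rewrite p1E p2E q1E /b; field.
by rewrite n0 d0.
Qed.

End Parabola.

(* The potentials are counted as functions on the punctured plane, i.e. after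
   restriction by [sigL], so that the value at the origin plays no role. *)
Theorem theorem5 (R : realType) (s : R) :
  infinite_set (sigL (punctured_plane R) @`
    [set V : R * R -> R |
      smooth_on (punctured_plane R) V /\
      forall B : set (R * R), focused_parabola B (q1_axis R) ->
        integrable_reflection_wall (hamiltonian s V) B]).
Proof.
pose V n (q : R * R) := n%:R * q.1.
set S := (X in infinite_set X) => finS.
apply: infinite_nat.
(* All [V n] qualify, so if [S] were finite, injectivity of [V] after restriction would make [nat]
   finite. *)
have -> : [set: nat] = (fun n => sigL (punctured_plane R) (V n)) @^-1` S.
  apply/esym/seteqP; split=> // n _; exists (V n) => //; split.
    move=> m; apply: class_C_mul.
    - exact: open_punctured_plane.
    - exact: class_C_cst (@open_punctured_plane R) _ _.
    - by apply: class_C_linear; [exact: open_punctured_plane|exact: continuous_fst].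
  move=> B /focused_parabolaE[d d0 ->] E.
  exists (stark_integral s n%:R); split.
  - exact: smooth_stark_integral.
  - exact: stark_integral_preserved_by_motion.
  - exact: stark_integral_preserved_by_reflections.
  - exact: independent_on_level_stark.
apply: finite_preimage finS => n m _ _ /= nm.
(* Injectivity follows from evaluation at (1, 0), where [V n] takes the value n. *)
have e1 : ((1, 0) : R * R) \in punctured_plane R.
  by rewrite inE => -[/eqP]; rewrite oner_eq0.
have := congr1 (fun f => f (SigSub e1)) nm.
by rewrite /V /= !mulr1 => /eqP; rewrite eqr_nat => /eqP.
Qed.
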